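(* Suppose that $X$ is a real-valued random variable with mean zero and variance $\sigma^{2}\in(0,\infty)$. Let $X^{z}$ have the zero bias distribution with respect to $X$ and let $B\sim\mathrm{Beta}(2,1)$ be independent of $X^{z}$. Then $X^{L}:=BX^{z}$ satisfies \[ \mathbb{E}[f(X)]-f(0)=\frac{\sigma^{2}}{2}\,\mathbb{E}[f''(X^{L})] \] for all twice-differentiable $f:\mathbb{R}\to\mathbb{R}$ with $\|f\|_{\infty},\|f'\|_{\infty},\|f''\|_{\infty}<\infty$.
   Context: For a random variable $X$ with mean zero and variance in $(0,\infty)$, a random variable $X^{z}$ has the zero bias distribution with respect to $X$ if $\mathbb{E}[Xf(X)]=\mathbb{E}[X^{2}]\,\mathbb{E}[f'(X^{z})]$ for all absolutely continuous $f$ for which $\mathbb{E}|Xf(X)|<\infty$ (such a distribution is known to exist for every such $X$). $\mathrm{Beta}(2,1)$ is the distribution with density $2x\,1_{[0,1]}(x)$. $\|\cdot\|_\infty$ is the supremum norm. *)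

(* Defs.v *)
From HB Require Import structures.
From mathcomp Require Import all_boot all_order all_algebra.
From mathcomp Require Import all_classical all_reals all_analysis.

Set Implicit Arguments.
Unset Strict Implicit.
Unset Printing Implicit Defensive.

Import Order.TTheory GRing.Theory Num.Theory.
Import numFieldNormedType.Exports.

Local Open Scope classical_set_scope.
Local Open Scope ring_scope.

Definition abs_cont_on (R : realType) (a b : R) (f : R -> R) : Prop :=
  forall e : R, 0 < e -> exists2 d : R, 0 < d &
    forall (n : nat) (u v : 'I_n -> R),
      (forall i, [/\ a <= u i, u i <= v i & v i <= b]) ->
      trivIset setT (fun i => `]u i, v i[%classic) ->
      \sum_(i < n) (v i - u i) < d ->
      \sum_(i < n) `|f (v i) - f (u i)| < e.

(* On the whole line, absolute continuity is meant in the local sense (on every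
   compact interval), which is equivalent to f being an indefinite integral. *)
Definition abs_cont (R : realType) (f : R -> R) : Prop :=
  forall a b : R, a <= b -> abs_cont_on a b f.

(* The derivative f^`() of an absolutely continuous f is only meaningful almost
   everywhere; where f is not derivable, derive1 takes a default value, which is
   harmless because zero bias distributions have a Lebesgue density.
   E|X f(X)| < oo does not imply that E[f'(Z)] exists (f' may oscillate too
   fast when X is unbounded), hence the second integrability condition: without
   it, some X would have no zero bias distribution. *)
Definition zero_bias (R : realType) (d d' : measure_display)
    (T : measurableType d) (T' : measurableType d')
    (P : probability T R) (Q : probability T' R)
    (X : {RV P >-> R}) (Z : {RV Q >-> R}) : Prop :=
  forall f : R -> R, abs_cont f ->
    ('E_P[(fun w => `|X w * f (X w)|)%R] < +oo)%E ->
    ('E_Q[(fun w => `|f^`()%classic (Z w)|)%R] < +oo)%E ->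
    ('E_P[(fun w => X w * f (X w))%R] =
     'E_P[(fun w => X w ^+ 2)%R] * 'E_Q[(fun w => f^`()%classic (Z w))%R])%E.

Definition independent_RV (R : realType) (d : measure_display)
    (T : measurableType d) (P : probability T R) (X Y : {RV P >-> R}) : Prop :=
  forall A B : set R, measurable A -> measurable B ->
    P (X @^-1` A `&` Y @^-1` B) = (P (X @^-1` A) * P (Y @^-1` B))%E.

Definition sup_norm (R : realType) (f : R -> R) : \bar R :=
  ereal_sup (range (fun x => `|f x|%:E)).

(* Main.v *)
Require Import Defs.
From HB Require Import structures.
From mathcomp Require Import all_boot all_order all_algebra.
From mathcomp Require Import all_classical all_reals all_analysis.
From mathcomp Require Import measurable_realfun.
From mathcomp Require Import ring lra.

(** Taking g(x) = (f(x) - f(0)) / x as test function in the zero bias identity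
    gives the result: X g(X) = f(X) - f(0), so that
      E[f(X)] - f(0) = E[X g(X)] = sigma^2 E[g'(X^z)],
    and g' is an average of f'' against the Beta(2,1) weight,
      g'(z) = int_0^1 t f''(t z) dt = E[f''(B z)] / 2,
    so that independence of B and X^z turns E[g'(X^z)] into E[f''(B X^z)] / 2.

    Two points need care. First, g must be an admissible test function,
    including at 0: a second order Taylor expansion shows that g is derivable
    there, with g'(0) = f''(0) / 2 ([is_derive_secant_slope]), and the mean
    value theorem applied to t f'(t) - f(t) bounds g' by the supremum of |f''|
    ([secant_slope_deriv_bound]); hence g is Lipschitz, thus absolutely
    continuous, and both expectations in the identity converge since f and g'
    are bounded.

    Second, f'' is only assumed to exist and to be bounded, so that it need be
    neither continuous nor Riemann integrable, and the integral formula for g'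
    ([integral_secant_slope_deriv]) rests on the fundamental theorem of calculus
    in the form: a function that is derivable everywhere, with locally bounded
    derivative, is the Lebesgue integral of its derivative
    ([integral_locally_bounded_derive]). It is obtained by dominated convergence
    from difference quotients, which are continuous and whose integrals are
    differences of difference quotients of a primitive. The same approximation
    shows that such derivatives are Borel functions. *)

Set Implicit Arguments.
Unset Strict Implicit.
Unset Printing Implicit Defensive.

Import Order.TTheory GRing.Theory Num.Theory.
Import numFieldNormedType.Exports.

Local Open Scope classical_set_scope.
Local Open Scope ring_scope.

(** * Functions with a prescribed derivative everywhere *)

Section DifferenceQuotients.
Context {R : realType}.
Implicit Types (F dF : R -> R) (x y t M C : R).

Lemma is_derive1P F x l : is_derive x 1 F l <->
  (h^-1 * (F (x + h) - F x)) @[h --> 0^'] --> l.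
Proof.
have E : (fun h : R => h^-1 * (F (x + h) - F x)) =
  (fun h => h^-1 *: ((F \o shift x) (h *: (1 : R)) - F x)).
  by apply/funext => h; rewrite /= [h *: 1]mulr1 [x + h]addrC.
rewrite E; split=> [[dF <-]|Fl]; first exact: dF.
by split; [apply/cvg_ex; exists l|exact/cvg_lim].
Qed.

(** Realizing a derivative as a limit of a sequence, rather than along a filter,
    is what makes it accessible to measurability and convergence theorems. *)
Lemma cvg_harmonic_quotient F x l : is_derive x 1 F l ->
  (n.+1%:R * (F (x + harmonic n) - F x)) @[n --> \oo] --> l.
Proof.
move=> /is_derive1P /cvgr_dnbhsP /(_ harmonic) Fl.
under eq_fun do rewrite -[_.+1%:R]invrK.
apply: Fl; split; last exact: cvg_harmonic.
by move=> n; rewrite gt_eqF// invr_gt0.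
Qed.

Lemma is_derive_continuous F dF :
  (forall x, is_derive x 1 F (dF x)) -> continuous F.
Proof.
by move=> FdF x; have [/derivable1_diffP/differentiable_continuous] := FdF x.
Qed.

Lemma continuous_harmonic_quotient F n : continuous F ->
  continuous (fun x => n.+1%:R * (F (x + harmonic n) - F x)).
Proof.
move=> cF x; apply: cvgMr; apply: cvgB; last exact: cF.
apply: (@cvg_comp _ _ _ (fun y => y + harmonic n) F); last exact: cF.
by apply: cvgD; [exact: cvg_id|exact: cvg_cst].
Qed.

(** The bound on [dF] is asked only on the ball centred at [y] with radius
    [`|x - y|]: near a point where [dF] vanishes, a constant [C] proportional to
    this radius gives a remainder of second order. *)
Lemma mean_value_bound F dF C x y : (forall t, is_derive t 1 F (dF t)) ->
  (forall t, `|t - y| <= `|x - y| -> `|dF t| <= C) ->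
  `|F x - F y| <= C * `|x - y|.
Proof.
move=> FdF dFC.
have cF a b : {within `[a, b], continuous F}.
  by apply: derivable_within_continuous => z _; have [] := FdF z.
have [xy|xy|->] := ltgtP x y; last by rewrite !subrr !normr0 mulr0.
- have [c] := MVT xy (fun z _ => FdF z) (cF _ _).
  rewrite in_itv/= => /andP[xc cy] Fyx.
  rewrite distrC Fyx normrM distrC ler_wpM2r// dFC//.
  by rewrite !ltr0_norm ?subr_lt0// lerN2 lerD2r ltW.
- have [c] := MVT xy (fun z _ => FdF z) (cF _ _).
  rewrite in_itv/= => /andP[yc cx] ->.
  rewrite normrM ler_wpM2r// dFC//.
  by rewrite !gtr0_norm ?subr_gt0// lerD2r ltW.
Qed.

Lemma lipschitz_abs_cont F M : (forall x y, `|F x - F y| <= M * `|x - y|) ->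
  abs_cont F.
Proof.
move=> FM a b _ e e0.
pose K := `|M| + 1; have K0 : 0 < K by rewrite ltr_wpDl.
(* [M] may be zero, so it is replaced by a positive constant to divide by. *)
exists (e / K); first by rewrite divr_gt0.
move=> n u v uv _ suv.
apply: (@le_lt_trans _ _ (\sum_(i < n) K * (v i - u i))).
  apply: ler_sum => i _; apply: le_trans (FM _ _) _.
  have [_ uvi _] := uv i.
  rewrite ger0_norm ?subr_ge0// ler_wpM2r ?subr_ge0//.
  by rewrite (le_trans (ler_norm M))// lerDl.
by rewrite -mulr_sumr mulrC -ltr_pdivlMr.
Qed.

(** A derivative is the pointwise limit of continuous difference quotients. *)
Lemma is_derive_measurable F dF : (forall x, is_derive x 1 F (dF x)) ->
  measurable_fun setT dF.
Proof.
move=> FdF.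
apply: (@measurable_fun_cvg _ _ _ _
  (fun n x => n.+1%:R * (F (x + harmonic n) - F x))); last first.
  by move=> x _; exact: cvg_harmonic_quotient.
move=> n; apply: continuous_measurable_fun.
exact/continuous_harmonic_quotient/(is_derive_continuous FdF).
Qed.

End DifferenceQuotients.

(** * Fundamental theorem of calculus for a possibly discontinuous derivative *)

Section FTC.
Context {R : realType}.
Notation mu := (@lebesgue_measure R).
Implicit Types (F dF : R -> R) (x y M : R).

Lemma is_derive_translate F c x l :
  is_derive (x + c) 1 F l -> is_derive x 1 (fun y => F (y + c)) l.
Proof.
move=> /is_derive1P Fl; apply/is_derive1P.
by under eq_fun do rewrite addrAC.
Qed.

(** With [H] a primitive of [F], the integral over [a, b] of the difference
    quotient of [F] with step [harmonic n] is the difference between [b] and [a]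
    of the same quotient of [H]; it tends to [F b - F a] since [H] has derivative
    [F]. The quotients of [F] converge to [dF] and, by the mean value theorem,
    are dominated by a bound of [dF] on a slightly larger interval. *)
Lemma integral_locally_bounded_derive F dF a b :
  (forall x, is_derive x 1 F (dF x)) ->
  (forall r, exists M, forall x, `|x| <= r -> `|dF x| <= M) -> a < b ->
  (\int[mu]_(x in `[a, b]) (dF x)%:E = (F b - F a)%:E)%E.
Proof.
move=> FdF /(_ (`|a| + `|b| + 1))[M dFM] ab.
have cF : continuous F := is_derive_continuous FdF.
(* The primitive starts before [a], so that it is derivable at [a] as well. *)
pose H x := (\int[mu]_(t in `[a - 1, x]) F t)%R.
have HF x : a - 1 < x -> is_derive x 1 H (F x).
  move=> ax.
  have iF : mu.-integrable `[a - 1, x + 1] (EFin \o F).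
    apply: continuous_compact_integrable; first exact: segment_compact.
    exact: continuous_subspaceT.
  have xx : x < x + 1 by rewrite ltrDl.
  have [dH H'F] := continuous_FTC1_closed xx iF ax (cF x).
  by split; [exact: dH|rewrite -derive1E; exact: H'F].
pose q n t := n.+1%:R * (F (t + harmonic n) - F t).
pose K n t := n.+1%:R * (H (t + harmonic n) - H t).
have h0 n : 0 < @harmonic R n by rewrite invr_gt0.
have Kq n t : a - 1 < t -> is_derive t 1 (K n) (q n t).
  move=> at1; apply: is_deriveZ; apply: is_deriveB; last exact: HF.
  apply: is_derive_translate; apply: HF.
  by rewrite (lt_trans at1)// ltrDl.
have cq n : continuous (q n) by exact: continuous_harmonic_quotient.
have a1a : a - 1 < a by rewrite gtrBl.
have iq n : (\int[mu]_(x in `[a, b]) (q n x)%:E = (K n b)%:E - (K n a)%:E)%E.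
  have cK x : a - 1 < x -> {for x, continuous (K n)}.
    move=> ax; apply: differentiable_continuous; apply/derivable1_diffP.
    by have [] := Kq n x ax.
  apply: continuous_FTC2 => //.
  - exact: continuous_subspaceT.
  - split.
    + move=> x; rewrite in_itv/= => /andP[ax _].
      by have [] := Kq n x (lt_trans a1a ax).
    + by apply: cvg_at_right_filter; exact: cK.
    + by apply: cvg_at_left_filter; apply: cK; exact: lt_trans ab.
  - move=> x; rewrite in_itv/= => /andP[ax _].
    by have [_] := Kq n x (lt_trans a1a ax); rewrite derive1E.
have KF x : a - 1 < x -> K ^~ x @ \oo --> F x.
  by move=> /HF/cvg_harmonic_quotient.
have limK : (\int[mu]_(x in `[a, b]) (q n x)%:E)%E @[n --> \oo] -->
    (F b - F a)%:E.
  under eq_fun do rewrite iq -EFinB.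
  apply: cvg_EFin; first by near=> n.
  by apply: cvgB; apply: KF => //; exact: lt_trans ab.
have qM n x : a <= x <= b -> `|q n x| <= M.
  move=> /andP[ax xb].
  have h1 : @harmonic R n <= 1 by rewrite invf_le1// ler1n.
  rewrite /q normrM ger0_norm// mulrC -ler_pdivlMr//.
  have := @mean_value_bound _ F dF M (x + harmonic n) x FdF.
  rewrite addrAC subrr add0r (gtr0_norm (h0 n)); apply=> t tx.
  apply: dFM; rewrite -(subrK x t) (le_trans (ler_normD _ _))// addrC.
  rewrite lerD//; last exact: le_trans h1.
  rewrite ler_norml; have := ler_norm b; have := ler_norm (- a).
  have := normr_ge0 a; have := normr_ge0 b.
  by rewrite normrN => ? ? ? ?; apply/andP; split; lra.
have mq n : measurable_fun `[a, b] (EFin \o q n).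
  by apply/measurable_EFinP/measurable_funTS; exact: continuous_measurable_fun.
have mdF : measurable_fun `[a, b] (EFin \o dF).
  by apply/measurable_EFinP/measurable_funTS; exact: is_derive_measurable FdF.
have qdF : {ae mu, forall x, `[a, b]%classic x ->
    (EFin \o q n) x @[n --> \oo] --> (EFin \o dF) x}.
  apply: aeW => x _; apply: cvg_EFin; first by near=> n.
  exact: cvg_harmonic_quotient.
have iM : mu.-integrable `[a, b] (EFin \o cst M).
  apply: continuous_compact_integrable; first exact: segment_compact.
  by apply: continuous_subspaceT => x; exact: cvg_cst.
have qM' : {ae mu, forall x n, `[a, b]%classic x ->
    (`|(EFin \o q n) x| <= (EFin \o cst M) x)%E}.
  by apply: aeW => x n xab; rewrite /= lee_fin qM.
have [_ _ limq] := @dominated_convergence _ _ R mu _ (measurable_itv _) _ _ _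
  mq mdF qdF iM qM'.
exact: cvg_unique limq limK.
Unshelve. all: by end_near.
Qed.

End FTC.

(** * The slope of the secant from the origin *)

Section Secant.
Context {R : realType}.
Notation mu := (@lebesgue_measure R).
Context (f d1 d2 : R -> R) (M : R).
Context (fd1 : forall x : R, is_derive x 1 f (d1 x)).
Context (d1d2 : forall x : R, is_derive x 1 d1 (d2 x)).
Context (d2M : forall x : R, `|d2 x| <= M).

Definition secant_slope x := if x == 0 then d1 0 else (f x - f 0) / x.

Definition secant_slope_deriv x :=
  if x == 0 then d2 0 / 2 else (x * d1 x - (f x - f 0)) / x ^+ 2.

Lemma mul_secant_slope x : x * secant_slope x = f x - f 0.
Proof.
rewrite /secant_slope; case: eqVneq => [->|x0]; first by rewrite mul0r subrr.
by rewrite mulrC divfK.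
Qed.

(** Up to sign, the height at which the tangent at [x] meets the vertical axis.
    In its derivative the terms in [d1] cancel, which is why the numerator of
    [secant_slope_deriv] is governed by [d2] alone. *)
Lemma is_derive_tangent_intercept (x : R) :
  is_derive x 1 (fun t => t * d1 t - f t) (x * d2 x).
Proof.
apply: (is_derive_eq
  (is_deriveB (is_deriveM (is_derive_id x 1) (d1d2 x)) (fd1 x))).
by rewrite /GRing.scale/= mulr1 addrK.
Qed.

(** The function [f t - t d1(0) - t^2 d2(0) / 2] has derivative
    [d1(t) - d1(0) - t d2(0)], which derivability of [d1] at the single point 0
    makes smaller than [e |t|] near 0, whether or not [d2] is continuous. *)
Lemma cvg_taylor_remainder :
  (h ^- 2 * (f h - f 0 - h * d1 0)) @[h --> 0^'] --> d2 0 / 2.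
Proof.
apply/cvgrPdist_le => /= e e0.
have /is_derive1P/cvgrPdist_le/(_ e e0) := d1d2 0.
rewrite !near_withinE/= => -[r/= r0 He].
exists r => //= x xr x0.
rewrite distrC.
pose F t := f t - t * d1 0 - t ^+ 2 * (d2 0 / 2).
have FdF (t : R) : is_derive t 1 F (d1 t - d1 0 - t * d2 0).
  apply: (is_derive_eq (is_deriveB (is_deriveB (fd1 t)
     (is_deriveM (is_derive_id t 1) (is_derive_cst (d1 0) t 1)))
     (is_deriveM (is_deriveX 2 (is_derive_id t 1))
        (is_derive_cst (d2 0 / 2) t 1)))).
  by rewrite /GRing.scale/=; field.
have -> : x ^- 2 * (f x - f 0 - x * d1 0) - d2 0 / 2 = (F x - F 0) / x ^+ 2.
  by rewrite /F; field.
rewrite normrM normfV normrX ler_pdivrMr ?exprn_gt0 ?normr_gt0// expr2 mulrA.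
have := @mean_value_bound _ F _ (e * `|x|) x 0 FdF.
rewrite subr0; apply=> t; rewrite subr0 => tx.
have [->|t0] := eqVneq t 0.
  by rewrite subrr mul0r subr0 normr0 mulr_ge0// ltW.
have -> : d1 t - d1 0 - t * d2 0 = (t^-1 * (d1 (0 + t) - d1 0) - d2 0) * t.
  by rewrite add0r; field.
rewrite normrM ler_pM// distrC He//= sub0r normrN.
by apply: le_lt_trans tx _; rewrite -normrN -sub0r.
Qed.

(** Away from 0 this is the quotient rule; at 0, the difference quotient of the
    secant slope is the second order Taylor remainder of [f] divided by [h^2]. *)
Lemma is_derive_secant_slope (x : R) :
  is_derive x 1 secant_slope (secant_slope_deriv x).
Proof.
rewrite /secant_slope_deriv; case: eqVneq => [->|x0].
  apply/is_derive1P; move: cvg_taylor_remainder; apply: cvg_trans.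
  apply: near_eq_cvg; rewrite near_withinE; near=> h => h0.
  by rewrite /secant_slope add0r eqxx (negbTE h0); field.
have ds : is_derive x 1 (fun t => (f t - f 0) * t^-1)
    ((x * d1 x - (f x - f 0)) / x ^+ 2).
  apply: (is_derive_eq (is_deriveM
    (is_deriveB (fd1 x) (is_derive_cst (f 0) x 1))
    (is_deriveV x0 (is_derive_id x 1)))).
  by rewrite /GRing.scale/= !fctE; field.
apply: near_eq_is_derive ds; near=> t.
rewrite /secant_slope ifN//; near: t.
exact: (cvgr_neq0 x (@cvg_id _ (nbhs x)) x0).
Unshelve. all: by end_near.
Qed.

(** The mean value theorem for [t d1(t) - f(t)], whose derivative [t d2(t)] is at
    most [M |x|] between 0 and [x], bounds the numerator by [M x^2]. *)
Lemma secant_slope_deriv_bound x : `|secant_slope_deriv x| <= M.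
Proof.
rewrite /secant_slope_deriv; case: eqVneq => [_|x0].
  have := d2M 0; have := normr_ge0 (d2 0).
  by rewrite normrM [`|2^-1|]ger0_norm//; lra.
rewrite normrM normfV normrX ler_pdivrMr ?exprn_gt0 ?normr_gt0//.
have := @mean_value_bound _ _ _ (M * `|x|) x 0 is_derive_tangent_intercept.
have -> : x * d1 x - (f x - f 0) = x * d1 x - f x - (0 * d1 0 - f 0) by ring.
rewrite subr0 expr2 mulrA; apply=> t.
by rewrite subr0 normrM mulrC => tx; rewrite ler_pM.
Qed.

(** For nonzero [z] a primitive of [t d2(t z)] in [t] is
    [(t z d1(t z) - f(t z)) / z^2]; for [z = 0] the integrand is [t d2(0)]. The
    integrand is unbounded on the line because of the factor [t], hence the
    local form of the bound in [integral_locally_bounded_derive]. *)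
Lemma integral_secant_slope_deriv z :
  (\int[mu]_(t in `[0%R, 1%R]) (t * d2 (t * z))%:E =
   (secant_slope_deriv z)%:E)%E.
Proof.
have bnd r : exists N, forall t, `|t| <= r -> `|t * d2 (t * z)| <= N.
  by exists (r * M) => t tr; rewrite normrM ler_pM.
have dscal (t : R) : is_derive t 1 (fun s => s * z) z.
  apply: (is_derive_eq (is_deriveM (is_derive_id t 1) (is_derive_cst z t 1))).
  by rewrite /GRing.scale/=; ring.
rewrite /secant_slope_deriv; case: eqVneq => [z0|z0].
  pose F t : R := t ^+ 2 * (d2 0 / 2).
  rewrite (@integral_locally_bounded_derive _ F _ 0 1 _ bnd)//.
    by rewrite /F expr0n/= mul0r subr0 expr1n mul1r.
  move=> t; rewrite z0 mulr0.
  apply: (is_derive_eq (is_deriveM (is_deriveX 2 (is_derive_id t 1))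
    (is_derive_cst (d2 0 / 2) t 1))).
  by rewrite /GRing.scale/=; field.
pose F t := ((t * z) * d1 (t * z) - f (t * z)) / z ^+ 2.
rewrite (@integral_locally_bounded_derive _ F _ 0 1 _ bnd)//.
  by rewrite /F !mul0r !mul1r; congr EFin; field.
move=> t.
pose L s := s * d1 s - f s.
have dL := @is_derive1_comp _ L _ t _ _
  (is_derive_tangent_intercept (t * z)) (dscal t).
apply: (is_derive_eq (is_deriveM dL (is_derive_cst (z ^- 2) t 1))).
by rewrite /GRing.scale/=; field.
Qed.

End Secant.

(** * Integrals against laws of random variables *)

(** Independence says that the law of the pair [(U, V)] and the product of the
    laws agree on rectangles, hence everywhere; Fubini's theorem then allows [V]
    to be integrated out first. *)
Lemma independent_integral (R : realType) (d : measure_display)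
    (T : measurableType d) (Q : probability T R) (U V : {RV Q >-> R})
    (h : R * R -> \bar R) :
  independent_RV U V -> measurable_fun setT h ->
  Q.-integrable setT (fun w => h (U w, V w)) ->
  (\int[Q]_w h (U w, V w) = \int[Q]_w \int[distribution Q V]_v h (U w, v))%E.
Proof.
move=> UV mh ih.
pose W w := (U w, V w).
have mW : measurable_fun setT W by exact: measurable_fun_pair.
pose W' : {mfun T >-> _} := MeasurableFun.Pack
  (MeasurableFun.Class (isMeasurableFun.Build _ _ _ _ _ mW)).
have law A : measurable A ->
    (distribution Q U \x distribution Q V)%E A = distribution Q W' A.
  by move=> mA; apply: product_measure_unique => // A1 A2; exact: UV.
have ihW : (distribution Q W').-integrable setT h.
  exact: integrable_pushforward.
have ihUV : (distribution Q U \x distribution Q V)%E.-integrable setT h.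
  apply/integrableP; split => //.
  rewrite (eq_measure_integral (distribution Q W')); last first.
    by move=> A mA _; exact: law.
  by have /integrableP[] := ihW.
transitivity (\int[distribution Q W']_z h z)%E.
  by rewrite integral_pushforward.
rewrite -(eq_measure_integral (distribution Q W') (fun A mA _ => law A mA)).
rewrite -integral12_prod_meas1//.
have /integrableP[mF iF] := integrable_fubini_F ihUV.
rewrite integral_pushforward//=.
rewrite preimage_setT; apply/integrableP; split.
  by apply: (measurableT_comp mF); exact: measurable_funPT.
move: iF; rewrite ge0_integral_pushforward//.
by apply: (measurableT_comp _ mF).
Qed.

Lemma independent_RVC (R : realType) (d : measure_display)
    (T : measurableType d) (Q : probability T R) (U V : {RV Q >-> R}) :
  independent_RV U V -> independent_RV V U.
Proof. by move=> UV A B mA mB; rewrite setIC UV// muleC. Qed.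

(** The sigma-algebra of [measurableTypeR R] is that of [R], but the two carry
    different displays, so that measures on them cannot be compared directly.
    The integral against the law of [U] is therefore moved to the sample space,
    then back to the law of [U] seen as a variable in [measurableTypeR R]. *)
Lemma integral_law (R : realType) (d : measure_display)
    (T : measurableType d) (Q : probability T R) (U : {RV Q >-> R})
    (n : {measure set (measurableTypeR R) -> \bar R}) (h : R -> \bar R) :
  (forall A : set R, measurable A -> distribution Q U A = n A) ->
  measurable_fun setT h -> Q.-integrable setT (h \o U) ->
  (\int[distribution Q U]_x h x = \int[n]_x h x)%E.
Proof.
move=> Un mh ih.
have mU : @measurable_fun _ _ T (measurableTypeR R) setT U.
  by move=> mT Y mY; exact: (@measurable_funPT _ _ _ _ U).
pose U' : {mfun T >-> measurableTypeR R} := MeasurableFun.Pack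
  (MeasurableFun.Class (isMeasurableFun.Build _ _ _ _ _ mU)).
transitivity (\int[distribution Q U']_x h x)%E.
  rewrite integral_pushforward//.
  by rewrite (@integral_pushforward _ _ _ (measurableTypeR R) _ U).
by apply: eq_measure_integral => A mA _; exact: Un.
Qed.

Lemma bounded_integrable (R : realType) (d : measure_display)
    (T : measurableType d) (mu : {measure set T -> \bar R}) (A : set T)
    (h : T -> R) M :
  measurable A -> (mu A < +oo)%E -> measurable_fun A h ->
  (forall x, A x -> `|h x| <= M) -> mu.-integrable A (EFin \o h).
Proof.
move=> mA muA mh hM; apply: measurable_bounded_integrable => //.
exists M; split; first exact: num_real.
by move=> N MN x Ax; apply: le_trans (hM x Ax) (ltW MN).
Qed.

(** The density of Beta(2,1) is [2 t] on the unit interval. *)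
Lemma integral_beta21 (R : realType) (h : R -> R) M :
  measurable_fun setT h -> (forall x, `|h x| <= M) ->
  (\int[beta_prob 2 1]_b (h b)%:E =
   2%:E * \int[lebesgue_measure]_(t in `[0%R, 1%R]) (t * h t)%:E)%E.
Proof.
move=> mh hM.
have ih : (beta_prob 2 1).-integrable setT (EFin \o h).
  apply: (@bounded_integrable _ _ _ _ _ _ M) => //.
  by rewrite -ge0_fin_numE//; exact: beta_prob_fin_num.
rewrite integral_beta_prob//; last 2 first.
- exact/measurable_EFinP.
- by have /integrableP[] := ih.
transitivity (\int[lebesgue_measure]_(t in `[0%R, 1%R]) (2 * (t * h t))%:E)%E.
  rewrite [RHS]integral_mkcond; apply: eq_integral => t _.
  rewrite /beta_pdf !patchE; case: ifPn => _; last by rewrite mul0r mule0.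
  rewrite XMonemXn0 beta_fun_fact/= -EFinM; congr EFin.
  by rewrite expr1 !factS fact0; field.
under eq_integral do rewrite EFinM.
rewrite integralZl//.
have m01 : (@lebesgue_measure R `[0%R, 1%R]%classic < +oo)%E.
  by rewrite lebesgue_measure_itv/= lte01 sube0 ltry.
have mth : measurable_fun setT (fun t : R => t * h t) by exact: measurable_funM.
apply: (@bounded_integrable R _ _ (@lebesgue_measure R) `[0, 1]%classic
  (fun t : R => t * h t) M) => //; first exact: measurable_funTS.
move=> t; rewrite /= in_itv/= => /andP[t0 t1].
by rewrite normrM -[M]mul1r ler_pM// ger0_norm.
Qed.

(** * From the zero bias identity to the Beta mixture *)

Lemma sup_norm_bound (R : realType) (f : R -> R) :
  (sup_norm f < +oo)%E -> exists M : R, forall x : R, `|f x| <= M.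
Proof.
move=> fy; exists (fine (sup_norm f)) => x.
have fx : (`|f x|%:E <= sup_norm f)%E by apply: ereal_sup_ubound; exists x.
rewrite -lee_fin fineK// ge0_fin_numE//.
by apply: le_trans fx; rewrite lee_fin.
Qed.

Lemma is_derive_derive1 (R : realType) (f : R -> R) (x : R) :
  derivable f x 1 -> is_derive x 1 f (f^`()%classic x).
Proof. by move=> fx; split => //; rewrite derive1E. Qed.

Lemma expectation_sqr_centered (R : realType) (d : measure_display)
    (T : measurableType d) (P : probability T R) (X : {RV P >-> R}) :
  ('E_P[X] = 0 -> 'E_P[(fun w => X w ^+ 2)%R] = 'V_P[X])%E.
Proof.
move=> EX; rewrite /variance covariance.unlock EX.
by congr expectation; apply/funext => w; rewrite expr2 -[X w]subr0.
Qed.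

(** Conditionally on [Z = z], the left-hand side averages [d2 (b * z)] over [b]
    with weight [2 b], which is twice [int_0^1 t d2(t z) dt]. *)
Lemma expectation_beta_mul (R : realType) (d : measure_display)
    (T : measurableType d) (Q : probability T R) (B Z : {RV Q >-> R})
    (f d1 d2 : R -> R) (M : R) :
  (forall x : R, is_derive x 1 f (d1 x)) ->
  (forall x : R, is_derive x 1 d1 (d2 x)) ->
  (forall x, `|d2 x| <= M) ->
  (forall A : set R, measurable A ->
    distribution Q B A = beta_prob 2 1 A) ->
  independent_RV B Z ->
  ('E_Q[(fun w => d2 (B w * Z w))%R] =
    2%:E * 'E_Q[(fun w => secant_slope_deriv f d1 d2 (Z w))])%E.
Proof.
move=> fd1 d1d2 d2M hB hind.
have md2 : measurable_fun setT d2 := is_derive_measurable d1d2.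
have mg : measurable_fun setT (secant_slope_deriv f d1 d2).
  exact: is_derive_measurable (is_derive_secant_slope fd1 d1d2).
have mZ : measurable_fun setT Z by exact: measurable_funPT.
have mB : measurable_fun setT B by exact: measurable_funPT.
have Qy : (Q setT < +oo)%E by rewrite probability_setT ltry.
rewrite !expectation.unlock.
pose h (z : R * R) := (d2 (z.2 * z.1))%:E.
rewrite (@independent_integral _ _ _ _ Z B h); last 3 first.
- exact: independent_RVC.
- apply/measurable_EFinP; apply: measurableT_comp => //.
  by apply: measurable_funM.
- apply: (@bounded_integrable _ _ _ _ _ (fun w => d2 (B w * Z w)) M) => //.
  by apply: measurableT_comp => //; exact: measurable_funM.
rewrite -integralZl//; last first.
  apply: (@bounded_integrable _ _ _ _ _
    (fun w => secant_slope_deriv f d1 d2 (Z w)) M) => //.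
    exact: measurableT_comp.
  by move=> w _; exact: secant_slope_deriv_bound.
apply: eq_integral => w _.
have md2Z : measurable_fun setT (fun b : R => d2 (b * Z w)).
  by apply: measurableT_comp => //; exact: measurable_funM.
have -> : (\int[distribution Q B]_b h (Z w, b) =
    \int[beta_prob 2 1]_b (d2 (b * Z w))%:E)%E.
  apply: (integral_law hB); first exact/measurable_EFinP.
  by apply: (@bounded_integrable _ _ _ _ _ (fun t => d2 (B t * Z w)) M) => //;
    exact: (measurableT_comp md2Z mB).
rewrite (@integral_beta21 _ (fun b => d2 (b * Z w)) M)//.
by rewrite (integral_secant_slope_deriv fd1 d1d2 d2M).
Qed.

Theorem theorem3p2 (R : realType) (d d' : measure_display)
    (T : measurableType d) (T' : measurableType d')
    (P : probability T R) (Q : probability T' R)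
    (X : {RV P >-> R}) (sigma : R) (Xz B : {RV Q >-> R})
    (sigma_gt0 : 0 < sigma)
    (EX : ('E_P[X] = 0)%E)
    (VX : ('V_P[X] = (sigma ^+ 2)%:E)%E)
    (hXz : zero_bias X Xz)
    (hB : forall A : set R, measurable A ->
       distribution Q B A = beta_prob 2 1 A)
    (hind : independent_RV B Xz) :
  let XL := fun w => B w * Xz w in
  forall f : R -> R,
    (forall x : R, derivable f x 1) ->
    (forall x : R, derivable f^`()%classic x 1) ->
    (sup_norm f < +oo)%E ->
    (sup_norm f^`()%classic < +oo)%E ->
    (sup_norm f^`(2)%classic < +oo)%E ->
    ('E_P[(fun w => f (X w))%R] - (f 0%R)%:E =
     (sigma ^+ 2 / 2)%:E * 'E_Q[(fun w => f^`(2)%classic (XL w))%R])%E.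
Proof.
move=> XL f df df1 /sup_norm_bound[N fN] _ /sup_norm_bound[M f2M].
have fd1 (x : R) := is_derive_derive1 (df x).
have d1d2 (x : R) := is_derive_derive1 (df1 x).
pose g := secant_slope f f^`()%classic.
pose g' := secant_slope_deriv f f^`()%classic f^`(2)%classic.
have gg' (x : R) : is_derive x 1 g (g' x) := is_derive_secant_slope fd1 d1d2 x.
have g'M (x : R) : `|g' x| <= M := secant_slope_deriv_bound fd1 d1d2 f2M x.
have g'E : g^`()%classic = g' by apply/funext => x; rewrite derive1E derive_val.
have Py : (P setT < +oo)%E by rewrite probability_setT ltry.
have Qy : (Q setT < +oo)%E by rewrite probability_setT ltry.
have mX : measurable_fun setT X by exact: measurable_funPT.
have mXz : measurable_fun setT Xz by exact: measurable_funPT.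
have ifX : P.-integrable setT (EFin \o (f \o X)).
  apply: (@bounded_integrable _ _ _ _ _ _ N) => //; last first.
    by move=> w _; exact: fN.
  apply: measurableT_comp => //; apply: continuous_measurable_fun => x.
  by apply: differentiable_continuous; exact/derivable1_diffP.
have ig'Z : Q.-integrable setT (EFin \o (g' \o Xz)).
  apply: (@bounded_integrable _ _ _ _ _ _ M) => //; last first.
    by move=> w _; exact: g'M.
  by apply: measurableT_comp => //; exact: is_derive_measurable gg'.
have XgE : (fun w => X w * g (X w)) = (fun w => f (X w) - f 0).
  by apply/funext => w; exact: mul_secant_slope.
have ifX0 : P.-integrable setT (EFin \o (fun w => f (X w) - f 0)).
  exact: (integrableB measurableT ifX
    (finite_measure_integrable_cst P (f 0) measurableT)).
have acg : abs_cont g.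
  apply: (@lipschitz_abs_cont _ _ M) => x y.
  by apply: (mean_value_bound gg') => t _.
have Xgy : ('E_P[(fun w => `|X w * g (X w)|)%R] < +oo)%E.
  rewrite expectation.unlock.
  under eq_integral => w _ do rewrite (mul_secant_slope f _ (X w)).
  by have /integrableP[] := ifX0.
have g'Zy : ('E_Q[(fun w => `|g^`()%classic (Xz w)|)%R] < +oo)%E.
  by rewrite expectation.unlock g'E; have /integrableP[] := ig'Z.
have := hXz g acg Xgy g'Zy; rewrite XgE g'E.
rewrite expectation_sqr_centered// VX => zb.
have -> : ('E_P[(fun w => f (X w))] - (f 0)%:E =
    'E_P[(fun w => f (X w) - f 0)%R])%E.
  rewrite expectation.unlock.
  under [RHS]eq_integral do rewrite EFinB.
  rewrite integralB//; last exact: finite_measure_integrable_cst.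
  by congr (_ - _)%E; rewrite -[LHS](expectation_cst P) expectation.unlock.
rewrite zb (expectation_beta_mul fd1 d1d2 f2M hB hind) muleA -EFinM.
by rewrite divfK.
Qed.
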